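(* There exist absolute constants $c_1,c_2,C>0$ such that the following holds. Let $m\ge d\ge1$, $\ell\ge1$ and $n,N\ge2$ be integers with $n$ a power of two, and let $f\colon[N]^m\to\{0,1\}^{\ell\log n+(\ell+1)n}$ be a $d$-local function. Then \[ \|f(\mathbf{U}_{[N]}^m)-\mathbf{D}_{n,\ell}\|_{TV}\ \ge\ 1-\exp\!\Big(-c_1\frac{n}{\ell^2 d\log N}\Big)-d\Big(\frac{C\,d\log N}{n}\Big)^{\ell}-\exp\!\big(d\ell\log(n)\log(N)-c_2 n\big). \]
   Context: $[N]=\{1,\dots,N\}$, $\mathbf{U}_{[N]}^m$ is the uniform distribution on $[N]^m$, and $f(\mathbf{X})$ denotes the distribution of $f(\mathbf{x})$ for $\mathbf{x}\sim\mathbf{X}$. A function $f\colon[N]^m\to\{0,1\}^n$ is $d$-local if each output bit depends on at most $d$ of the $m$ input coordinates. Total variation distance: $\|\mathbf{P}-\mathbf{Q}\|_{TV}=\max_{\mathcal{E}}(\mathbf{P}(\mathcal{E})-\mathbf{Q}(\mathcal{E}))$. Logarithms are base 2. Distribution $\mathbf{D}_{n,\ell}$: for $n\ge2$ a power of two and integer $\ell\ge1$, $\mathbf{D}_{n,\ell}$ is the distribution over $(\mathbf{i}^{(1)},\dots,\mathbf{i}^{(\ell)},\mathbf{x},\mathbf{y}^{(1)},\dots,\mathbf{y}^{(\ell)})\in\{0,1\}^{\ell\log n+(\ell+1)n}$ where each $\mathbf{i}^{(j)}$ is independently uniform on $\{0,1\}^{\log n}$ (identified with an element of $\mathbb{Z}_n$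 via a fixed bijection), $\mathbf{x}$ is uniform on $\{0,1\}^n$ independent of the shifts, and $\mathbf{y}^{(j)}_k=\mathbf{x}_{k+\mathbf{i}^{(j)}\bmod n}$ for all $j\in[\ell]$, $k\in[n]$. *)

(* Defs.v *)
From Stdlib Require Import Rdefinitions Rtrigo_def Rpower.
From HB Require Import structures.
From mathcomp Require Import all_boot all_order all_algebra.
From mathcomp Require Import Rstruct.
Set Implicit Arguments. Unset Strict Implicit. Unset Printing Implicit Defensive.
Import Order.TTheory GRing.Theory Num.Theory.

Definition local (m N L d : nat) (f : {ffun 'I_m -> 'I_N} -> {ffun 'I_L -> bool}) :=
  forall j : 'I_L, exists S : {set 'I_m},
    (#|S| <= d)%N /\
    forall x y : {ffun 'I_m -> 'I_N}, (forall i, i \in S -> x i = y i) -> f x j = f y j.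

Definition getb (n : nat) (a : {ffun 'I_n -> bool}) (i : nat) : bool :=
  if (insub i : option 'I_n) is Some j then a j else false.

(* output length  ell * log n + (ell+1) * n  with log n = k *)
Definition Dlen (k ell n : nat) : nat := ell * k + ell.+1 * n.

(* The string (i^(1),...,i^(ell), x, y^(1),...,y^(ell)) produced from the
   shift bit-strings s (s j = i^(j+1), in {0,1}^k) and x in {0,1}^n, where
   enc : {0,1}^k -> Z_n is the fixed bijection; indices are 0-based, so
   y^(j)_r = x_{(r + enc(i^(j))) mod n}. *)
Definition Dstring (k ell n : nat) (enc : {ffun 'I_k -> bool} -> 'I_n)
  (sx : {ffun 'I_ell -> {ffun 'I_k -> bool}} * {ffun 'I_n -> bool})
  : {ffun 'I_(Dlen k ell n) -> bool} :=
  let s := sx.1 in let x := sx.2 in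
  [ffun p : 'I_(Dlen k ell n) =>
    let p := val p in
    if (p < ell * k)%N then
      (if (insub (p %/ k) : option 'I_ell) is Some j then getb (s j) (p %% k)
       else false)
    else if (p < ell * k + n)%N then getb x (p - ell * k)
    else
      let q := p - ell * k - n in
      if (insub (q %/ n) : option 'I_ell) is Some j then
        getb x ((q %% n + val (enc (s j))) %% n)
      else false].

Local Open Scope ring_scope.

Definition log2 (x : R) : R := ln x / ln 2.

(* A "distribution" on a finite type U is represented by its probability
   of events {set U}.  The distribution g(U_T) of g(t) for t uniform on the
   finite type T: *)
Definition unif_push (T U : finType) (g : T -> U) (E : {set U}) : R :=
  #|[set t | g t \in E]|%:R / #|T|%:R.

Definition tv_dist (U : finType) (P Q : {set U} -> R) : R :=
  \big[Num.max/0]_(E : {set U}) (P E - Q E).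

Definition Ddist (k ell n : nat) (enc : {ffun 'I_k -> bool} -> 'I_n) :=
  unif_push (@Dstring k ell n enc).

(* Main.v *)
Require Import Defs.
From Stdlib Require Import Rdefinitions Rtrigo_def Rpower.
From HB Require Import structures.
From mathcomp Require Import all_boot all_order all_algebra.
From mathcomp Require Import Rstruct Rstruct_topology reals sequences exp lra ring zify.
Set Implicit Arguments. Unset Strict Implicit. Unset Printing Implicit Defensive.
Import Order.TTheory GRing.Theory Num.Theory.
Local Open Scope ring_scope.

(* Fix the cells deciding the shifts and the few cells read by very many output
   bits. Every remaining cell is then read by at most Delta = O(ell d log N) of
   the consistency checks [x_k = y^(j)_(k - i_j) for all j]. If many x_k are now
   biased, x is far from uniform. If not, then for all but an atypical choice of
   shifts most checks k have no cell common to all of their ell + 1 bits, so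
   resampling the cells piece by piece shows that the check fails with
   probability Omega(1/ell). Finner's inequality turns this into an
   exponentially small probability that every check succeeds. A union bound over
   the values of the fixed cells gives a single distinguishing event. *)

(** * Averages over a finite type *)

Definition avg (R : realFieldType) (T : finType) (g : T -> R) : R := (\sum_t g t) / #|T|%:R.

Section Average.
Context {R : realFieldType} {T : finType}.
Implicit Types g h : T -> R.

Lemma eq_avg g h : g =1 h -> avg g = avg h.
Proof. by move=> gh; rewrite /avg (eq_bigr h). Qed.

Lemma ler_avg g h : (forall t, g t <= h t) -> avg g <= avg h.
Proof. by move=> gh; rewrite ler_wpM2r ?invr_ge0 ?ler0n ?ler_sum. Qed.

Lemma avgD g h : avg (fun t => g t + h t) = avg g + avg h.
Proof. by rewrite /avg big_split /= mulrDl. Qed.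

Lemma avgZl (a : R) g : avg (fun t => a * g t) = a * avg g.
Proof. by rewrite /avg -mulr_sumr mulrA. Qed.

Lemma avg_sum (I : finType) (P : pred I) (F : I -> T -> R) :
  avg (fun t => \sum_(i | P i) F i t) = \sum_(i | P i) avg (F i).
Proof. by rewrite /avg exchange_big mulr_suml. Qed.

Lemma avg_cst (a : R) : (0 < #|T|)%N -> avg (fun _ : T => a) = a.
Proof.
move=> T0; rewrite /avg sumr_const -[a *+ _]mulr_natr mulfK //.
by rewrite pnatr_eq0 -lt0n.
Qed.

Lemma avg_ge0 g : (forall t, 0 <= g t) -> 0 <= avg g.
Proof. by move=> g0; rewrite divr_ge0 ?sumr_ge0 ?ler0n. Qed.

Lemma avg_gt0 g : (0 < #|T|)%N -> (forall t, 0 < g t) -> 0 < avg g.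
Proof.
move=> T0 g0; rewrite divr_gt0 ?ltr0n //.
have /card_gt0P[t _] := T0.
by rewrite (bigD1 t) //= ltr_wpDr ?g0 // sumr_ge0 // => u _; rewrite ltW.
Qed.

End Average.

(** * Mixing two points of a product space *)

Definition mix (I T : finType) (P : {set I}) (x y : {ffun I -> T}) :
  {ffun I -> T} := [ffun i => if i \in P then y i else x i].

Definition depends_on (I T : finType) (A : Type) (S : {set I})
    (g : {ffun I -> T} -> A) :=
  forall x y : {ffun I -> T}, (forall i, i \in S -> x i = y i) -> g x = g y.

(** Exchanging the coordinates in [P] between [x] and [y] is an involution on pairs that turns
    [mix P x y] into the first component. Cells can thus be fixed first and the others drawn
    afterwards. *)
Lemma avg_mix (R : realFieldType) (I T : finType) (P : {set I}) (g : {ffun I -> T} -> R) :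
  avg (fun y => avg (fun x => g (mix P x y))) = avg g.
Proof.
case: (posnP #|{ffun I -> T}|) => [T0|T0].
  by rewrite /avg T0 invr0 !mulr0.
pose s (p : {ffun I -> T} * {ffun I -> T}) := (mix P p.1 p.2, mix P p.2 p.1).
have sK : involutive s.
  move=> [x y]; congr pair; apply/ffunP=> i; rewrite !ffunE /=; by case: (i \in P).
rewrite /avg -mulr_suml exchange_big pair_big /=.
rewrite (reindex s) /=; last by exists s => p _; rewrite sK.
transitivity ((\sum_(p : {ffun I -> T} * {ffun I -> T}) g p.1) / #|{ffun I -> T}|%:R / #|{ffun I -> T}|%:R).
  congr (_ / _ / _); apply: eq_bigr => -[x y] _; congr g => /=.
  by apply/ffunP=> i; rewrite !ffunE; case: (i \in P).
rewrite -(pair_big predT predT (fun x _ => g x)) /=.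
under eq_bigr do rewrite sumr_const -mulr_natr.
by rewrite -mulr_suml mulfK // pnatr_eq0 -lt0n.
Qed.

(** * Finner's inequality *)

Definition qroot (R : realType) (q : nat) (x : R) : R := expR (ln x / q%:R).

Lemma qrootM (R : realType) (q : nat) (x y : R) :
  0 < x -> 0 < y -> qroot q (x * y) = qroot q x * qroot q y.
Proof.
move=> x0 y0; rewrite /qroot -expRD -mulrDl; congr (expR (_ / _)).
by rewrite lnM.
Qed.

Lemma ler_qroot (R : realType) (q : nat) (x y : R) : 0 < x -> x <= y -> qroot q x <= qroot q y.
Proof.
by move=> x0 xy; rewrite ler_expR ler_wpM2r ?invr_ge0 ?ler0n // ler_ln // posrE (lt_le_trans x0).
Qed.

Lemma qroot_exp (R : realType) (q : nat) (x : R) : qroot q (expR x) = expR (x / q%:R).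
Proof. by rewrite /qroot expRK. Qed.

(* Weighted AM-GM, the missing weight being put on the value 1. *)
Lemma prod_qroot_le (R : realType) (K : finType) (J : {set K}) (q : nat) (a : K -> R) :
  (#|J| <= q)%N -> (0 < q)%N -> (forall k, 0 < a k) ->
  \prod_(k in J) qroot q (a k) <= 1 + (\sum_(k in J) (a k - 1)) / q%:R.
Proof.
move=> Jq q0 a0; have q0R : 0 < q%:R :> R by rewrite ltr0n.
set M := 1 + _.
have ME : M = (\sum_(k in J) a k) / q%:R + (1 - #|J|%:R / q%:R).
  by rewrite /M sumrB sumr_const mulrBl; ring.
have M0 : 0 < M.
  rewrite ME; have [Jlt|Jge] := ltnP #|J| q.
    rewrite ltr_wpDl ?divr_ge0 ?sumr_ge0 ?ler0n//; first by move=> k _; rewrite ltW.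
    by rewrite subr_gt0 ltr_pdivrMr // mul1r ltr_nat.
  have JE : #|J| = q by apply/eqP; rewrite eqn_leq Jq.
  rewrite JE divff ?gt_eqF // subrr addr0 divr_gt0 //.
  have /card_gt0P[k kJ] : (0 < #|J|)%N by rewrite JE.
  by rewrite (bigD1 k) //= ltr_wpDr // sumr_ge0 // => i _; rewrite ltW.
rewrite -expR_sum -[leRHS](lnK M0) ler_expR -mulr_suml.
have tan (x : R) : 0 < x -> ln x - ln M <= x / M - 1.
  move=> x0; rewrite lerBrDl (le_trans (expR_ge1Dx _)) // expRD.
  by rewrite expRN !lnK.
have : (\sum_(k in J) (ln (a k) - ln M)) / q%:R + (1 - #|J|%:R / q%:R) * (- ln M) <=
       (\sum_(k in J) (a k / M - 1)) / q%:R + (1 - #|J|%:R / q%:R) * (M^-1 - 1).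
  apply: lerD.
    by rewrite ler_wpM2r ?invr_ge0 ?ler0n ?ler_sum // => k _; apply: tan.
  rewrite ler_wpM2l // ?subr_ge0 ?ler_pdivrMr ?mul1r ?ler_nat //.
  by have := tan 1 ltr01; rewrite ln1 sub0r mul1r.
rewrite !sumrB !sumr_const -mulr_suml -[ln M *+ _]mulr_natr.
have -> : (((\sum_(i in J) a i) / M - 1 *+ #|J|) / q%:R + (1 - #|J|%:R / q%:R) * (M^-1 - 1)) = 0.
  have -> : (\sum_(i in J) a i) = (M - 1 + #|J|%:R / q%:R) * q%:R.
    by rewrite ME; field; rewrite gt_eqF.
  by field; rewrite !gt_eqF.
set A := \sum_(i in J) ln _; set c := #|J|%:R : R; set Q := q%:R : R => H.
rewrite -subr_le0 (le_trans _ H) // le_eqVlt; apply/orP; left; apply/eqP.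
by field; rewrite gt_eqF.
Qed.

(** Hölder's inequality with at most [q] varying factors. Once each factor is divided by its mean,
    AM-GM bounds the product by a function of average 1; the factors outside [J] are constant, hence
    equal to their means. *)
Lemma holder_qroot (R : realType) (T K : finType) (B J : {set K}) (q : nat) (h : K -> T -> R) :
  (0 < #|T|)%N -> (0 < q)%N -> (#|J| <= q)%N -> J \subset B ->
  (forall k t, 0 < h k t) -> (forall k, k \in B :\: J -> forall t u, h k t = h k u) ->
  avg (fun t => \prod_(k in B) qroot q (h k t)) <= \prod_(k in B) qroot q (avg (h k)).
Proof.
move=> T0 q0 Jq JB h0 hc.
have m0 k : 0 < avg (h k) by apply: avg_gt0.
set P := \prod_(k in B) _.
have E t : \prod_(k in B) qroot q (h k t) =
     P * \prod_(k in J) qroot q (h k t / avg (h k)).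
  rewrite /P (big_setID J) [in RHS](big_setID J) /= (setIidPr JB).
  rewrite mulrAC -big_split /=; congr (_ * _); apply: eq_bigr => k kJ.
    by rewrite -qrootM // ?(divr_gt0 _ (m0 k)) //; congr (qroot q _); rewrite mulrC divfK ?gt_eqF.
  congr (qroot q _); rewrite -[LHS](@avg_cst R T) //; apply: eq_avg => u; exact: hc.
rewrite (eq_avg E) avgZl ler_piMr //; first by rewrite prodr_ge0 // => k _; exact/ltW/expR_gt0.
apply: (@le_trans _ _ (avg (fun t => 1 + (\sum_(k in J) (h k t / avg (h k) - 1)) / q%:R))).
  by apply: ler_avg => t; apply: prod_qroot_le => // k; rewrite divr_gt0.
rewrite avgD avg_cst // -[leRHS]addr0 lerD2l.
under eq_avg do rewrite mulrC.
rewrite avgZl avg_sum big1 ?mulr0 // => k _.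
rewrite avgD avg_cst // -(eq_avg (fun t => mulrC _ _)) avgZl mulVf ?subrr //.
by rewrite gt_eqF.
Qed.

(** Coordinates are averaged out one at a time. At most [q] of the functions may depend on a given
    coordinate, so each step is an instance of [holder_qroot]. *)
Lemma finner (R : realType) (I T K : finType) (B : {set K}) (S : K -> {set I}) (q : nat)
    (g : K -> {ffun I -> T} -> R) :
  (0 < #|{ffun I -> T}|)%N -> (0 < q)%N ->
  (forall i, #|[set k in B | i \in S k]| <= q)%N ->
  (forall k x, 0 < g k x) -> (forall k, depends_on (S k) (g k)) ->
  avg (fun x => \prod_(k in B) qroot q (g k x)) <= \prod_(k in B) qroot q (avg (g k)).
Proof.
move=> T0 q0 Sq g0 gS.
(* Here [G] is what remains of [g] once the coordinates in [s] are averaged out: the means are kept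
   and the average of the product has not decreased. *)
have step (s : seq I) : exists G : K -> {ffun I -> T} -> R,
  [/\ forall k x, 0 < G k x, forall k, depends_on (S k :\: [set i in s]) (G k),
      forall k, avg (G k) = avg (g k) &
      avg (fun x => \prod_(k in B) qroot q (g k x)) <=
      avg (fun x => \prod_(k in B) qroot q (G k x))].
  elim: s => [|i s [G [G0 GS GA GH]]].
    by exists g; split => // k x y xy; apply: gS => i iS; apply: xy; rewrite !inE.
  exists (fun k x => avg (fun y => G k (mix [set i] x y))); split.
  - by move=> k x; apply: avg_gt0.
  - move=> k x y xy; apply: eq_avg => z; apply: GS => j; rewrite !inE => /andP[js jS].
    rewrite !ffunE inE; case: eqP => // /eqP ji.
    by apply: xy; rewrite !inE (negPf ji) js.
  - move=> k; rewrite -GA -(avg_mix [set i] (G k)) /avg -!mulr_suml.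
    by rewrite exchange_big.
  - apply: le_trans GH _; rewrite -(avg_mix [set i]).
    rewrite [leLHS](_ : _ = avg (fun x => avg (fun y => \prod_(k in B) qroot q (G k (mix [set i] x y))))).
      apply: ler_avg => x.
      apply: (holder_qroot (J := [set k in B | i \in S k])) => //.
        by apply/subsetP=> k; rewrite inE => /andP[].
      move=> k; rewrite !inE => /andP[+ kB]; rewrite kB /= => iS t u.
      apply: GS => j; rewrite !inE => /andP[_ jS]; rewrite !ffunE inE.
      by case: eqP => // ji; rewrite -ji jS in iS.
    by rewrite /avg -!mulr_suml exchange_big.
have [G [G0 GS GA GH]] := step (enum I); apply: le_trans GH _.
have Gc k x : G k x = avg (g k).
  rewrite -GA -[LHS](@avg_cst R {ffun I -> T}) //; apply: eq_avg => y.
  by apply: GS => j; rewrite !inE mem_enum.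
rewrite (eq_avg (h := fun=> \prod_(k in B) qroot q (avg (g k)))) ?avg_cst // => x.
by apply: eq_bigr => k _; rewrite Gc.
Qed.

(** * Tail bounds and the resampling argument *)

(** Markov's inequality for the exponential of the sum divided by [q]. This division turns the
    exponential into a product of [q]-th roots, to which Finner's inequality applies. *)
Lemma chernoff (R : realType) (I T K : finType) (B : {set K})
    (S : K -> {set I}) (q : nat) (h : K -> {ffun I -> T} -> R) (a tau : R) :
  (0 < #|{ffun I -> T}|)%N -> (0 < q)%N ->
  (forall i, #|[set k in B | i \in S k]| <= q)%N ->
  (forall k, depends_on (S k) (h k)) ->
  (forall k, k \in B -> avg (fun x => expR (h k x)) <= expR a) ->
  avg (fun x => (tau <= \sum_(k in B) h k x)%R%:R) <=
    expR ((#|B|%:R * a - tau) / q%:R).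
Proof.
move=> T0 q0 Sq hS ha; have q0R : 0 < q%:R :> R by rewrite ltr0n.
apply: (@le_trans _ _ (avg (fun x => expR (- tau / q%:R) *
                              \prod_(k in B) qroot q (expR (h k x))))).
  apply: ler_avg => x.
  under eq_bigr do rewrite qroot_exp.
  rewrite -expR_sum -expRD -mulr_suml -mulrDl.
  case: (leP tau) => [le|_] /=; last exact: expR_ge0.
  by rewrite -[X in X <= _]expR0 ler_expR divr_ge0 ?ler0n // addrC subr_ge0.
rewrite avgZl mulrBl addrC expRD -mulNr ler_wpM2l ?expR_ge0 //.
apply: le_trans (finner T0 q0 Sq _ _) _.
- by move=> k x; exact: expR_gt0.
- by move=> k x y xy; rewrite (hS k x y).
apply: (@le_trans _ _ (\prod_(k in B) qroot q (expR a))).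
  apply: ler_prod => k kB; rewrite expR_ge0 /= ler_qroot ?ha //.
  by apply: avg_gt0 => // x; exact: expR_gt0.
by rewrite prodr_const qroot_exp -expRM_natl mulrA.
Qed.

Lemma avg_expR_bool (R : realType) (T : finType) (c : R) (b : T -> bool) :
  (0 < #|T|)%N ->
  avg (fun x => expR (c * (b x)%:R)) = 1 + (expR c - 1) * avg (fun x => (b x)%:R).
Proof.
move=> T0; rewrite -avgZl -[X in X + _](@avg_cst R T) // -avgD; apply: eq_avg => x.
by case: (b x); rewrite ?mulr1 ?mulr0 ?expR0; ring.
Qed.

Lemma avg_bool_ge0 (R : realFieldType) (T : finType) (b : T -> bool) :
  0 <= avg (fun x => (b x)%:R) :> R.
Proof. by apply: avg_ge0 => x; rewrite ler0n. Qed.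

Lemma avg_negb (R : realFieldType) (T : finType) (b : T -> bool) :
  (0 < #|T|)%N -> avg (fun x => (~~ b x)%:R) = 1 - avg (fun x => (b x)%:R) :> R.
Proof.
move=> T0; apply/eqP; rewrite eq_sym subr_eq -avgD -[X in X == _](@avg_cst R T) //.
by apply/eqP/eq_avg => x; case: (b x); rewrite ?add0r ?addr0.
Qed.

Lemma sumr_bool (R : realFieldType) (K : finType) (B : {set K}) (c : R) (b : K -> bool) :
  \sum_(k in B) c * (b k)%:R = c * #|[set k in B | b k]|%:R.
Proof.
rewrite -mulr_sumr -sum1_card natr_sum; congr (_ * _).
rewrite big_mkcond [in RHS]big_mkcond; apply: eq_bigr => k _.
by rewrite inE; case: (k \in B); case: (b k).
Qed.

(** An instance of [chernoff] with [h = - F] and threshold 0: since [expR (-1) <= 1/2], each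
    exponential mean is at most [1 - p / 2 <= expR (- (p / 2))]. *)
Lemma chernoff_none (R : realType) (I T K : finType) (B : {set K})
    (S : K -> {set I}) (q : nat) (F : K -> {ffun I -> T} -> bool) (p : R) :
  (0 < #|{ffun I -> T}|)%N -> (0 < q)%N ->
  (forall i, #|[set k in B | i \in S k]| <= q)%N ->
  (forall k, depends_on (S k) (F k)) ->
  (forall k, k \in B -> p <= avg (fun x => (F k x)%:R)) ->
  avg (fun x => [forall k in B, ~~ F k x]%:R) <= expR (- (#|B|%:R * p / (2 * q%:R))).
Proof.
move=> T0 q0 Sq FS Fp.
have := @chernoff R I T K B S q (fun k x => -1 * (F k x)%:R) (- (p / 2)) 0 T0 q0 Sq.
have q0R : q%:R != 0 :> R by rewrite pnatr_eq0 -lt0n.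
have -> : (#|B|%:R * - (p / 2) - 0) / q%:R = - (#|B|%:R * p / (2 * q%:R)) by field.
move=> H; apply: le_trans (H _ _) => [|k x y xy|k kB].
- apply: ler_avg => x; case: forallP => [Hx|_]; last exact: ler0n.
  rewrite big1 ?lexx // => k kB.
  by have := Hx k; rewrite kB; case: (F k x); rewrite ?mulr0.
- by rewrite (FS k x y).
rewrite avg_expR_bool // (le_trans _ (expR_ge1Dx _)) // lerD2l.
have e2 : expR (-1) <= 2^-1 :> R.
  by rewrite expRN lef_pV2 ?posrE ?expR_gt0 // -[2]/(1 + 1) expR_ge1Dx.
have := Fp k kB; have := avg_bool_ge0 R (F k); nra.
Qed.

(* The threshold [expR (-8) / 2] keeps the average of [expR (8 * Z k)] below 3/2. *)
Lemma chernoff_many (R : realType) (I T K : finType) (B : {set K})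
    (S : K -> {set I}) (q : nat) (Z : K -> {ffun I -> T} -> bool) :
  (0 < #|{ffun I -> T}|)%N -> (0 < q)%N ->
  (forall i, #|[set k in B | i \in S k]| <= q)%N ->
  (forall k, depends_on (S k) (Z k)) ->
  (forall k, k \in B -> avg (fun x => (Z k x)%:R) <= expR (-8) / 2 :> R) ->
  avg (fun x => (#|B| <= 8 * #|[set k in B | Z k x]|)%N%:R) <=
    expR (- (#|B|%:R / (2 * q%:R))) :> R.
Proof.
move=> T0 q0 Sq ZS Zp.
have := @chernoff R I T K B S q (fun k x => 8 * (Z k x)%:R) (1 / 2) #|B|%:R T0 q0 Sq.
have q0R : q%:R != 0 :> R by rewrite pnatr_eq0 -lt0n.
have -> : (#|B|%:R * (1 / 2) - #|B|%:R) / q%:R = - (#|B|%:R / (2 * q%:R)) :> R by field.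
move=> H; apply: le_trans (H _ _) => [|k x y xy|k kB].
- by apply: ler_avg => x; rewrite sumr_bool -natrM (ler_nat R #|B|).
- by rewrite (ZS k x y).
rewrite avg_expR_bool // (le_trans _ (expR_ge1Dx _)) // lerD2l.
have e8 : 1 <= expR 8 :> R by rewrite (le_trans _ (expR_ge1Dx _)) // lerDl.
have eN : expR 8 * expR (-8) = 1 :> R by rewrite expRxMexpNx_1.
have := Zp k kB; have := avg_bool_ge0 R (Z k).
set z := avg _; have := expR_gt0 (-8 : R); nra.
Qed.

Lemma avg_bit (R : realFieldType) (K : finType) (k : K) (b : bool) :
  avg (fun x : {ffun K -> bool} => (x k != b)%:R) = 2^-1 :> R.
Proof.
have T0 : (0 < #|{ffun K -> bool}|)%N by apply/card_gt0P; exists [ffun=> true].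
have : avg (fun x : {ffun K -> bool} => (~~ (x k != b))%:R) =
       avg (fun x : {ffun K -> bool} => (x k != b)%:R) :> R.
  rewrite /avg; congr (_ / _).
  pose s (x : {ffun K -> bool}) : {ffun K -> bool} := [ffun j => ~~ x j].
  have sK : involutive s by move=> x; apply/ffunP=> j; rewrite !ffunE negbK.
  rewrite (reindex s) /=; last by exists s => p _; rewrite sK.
  by apply: eq_bigr => x _; rewrite ffunE; case: (x k); case: b.
rewrite avg_negb // => H; lra.
Qed.

(** Each bit involves only its own coordinate, so [q] is 1. A disagreement counted with weight -1
    has exponential mean at most [3/4 <= expR (- (1/4))], and the threshold uses up half of the
    resulting exponent. *)
Lemma hamming_ball (R : realType) (K : finType) (B : {set K}) (b : K -> bool) :
  avg (fun x : {ffun K -> bool} => (8 * #|[set k in B | x k != b k]| <= #|B|)%N%:R) <=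
    expR (- (#|B|%:R / 8)) :> R.
Proof.
have T0 : (0 < #|{ffun K -> bool}|)%N by apply/card_gt0P; exists [ffun=> true].
have := @chernoff R K bool K B (fun k => [set k]) 1
  (fun k x => -1 * (x k != b k)%:R) (- (1 / 4)) (- (#|B|%:R / 8)) T0 isT.
have -> : (#|B|%:R * (- (1 / 4)) - - (#|B|%:R / 8)) / 1%:R = - (#|B|%:R / 8) :> R by field.
move=> H; apply: le_trans (H _ _ _) => [|i|k x y xy|k kB].
- by apply: ler_avg => x; rewrite sumr_bool mulN1r lerN2 ler_pdivlMr // mulrC -natrM (ler_nat R (8 * _)).
- rewrite -(cards1 i) subset_leq_card //; apply/subsetP => k.
  by rewrite !inE eq_sym => /andP[].
- by rewrite xy ?inE.
rewrite avg_expR_bool // avg_bit (le_trans _ (expR_ge1Dx _)) // lerD2l.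
have e2 : expR (-1) <= 2^-1 :> R.
  by rewrite expRN lef_pV2 ?posrE ?expR_gt0 // -[2]/(1 + 1) expR_ge1Dx.
lra.
Qed.

(* If the functions [g j] mostly agree, the coordinates outside [S j] can be
   resampled through [g j], one [j] after the other, so that [g j0] hardly
   notices that its whole argument has been replaced by an independent copy. *)
Lemma resample (R : realFieldType) (I T J : finType) (S : J -> {set I})
    (g : J -> {ffun I -> T} -> bool) (j0 : J) :
  (0 < #|{ffun I -> T}|)%N ->
  (forall j, depends_on (S j) (g j)) -> (forall i, exists j, i \notin S j) ->
  avg (fun y => avg (fun x => (g j0 x != g j0 y)%:R)) <=
    2 * #|J|%:R * avg (fun x => (~~ [forall j, g j x == g j0 x])%:R) :> R.
Proof.
move=> T0 gS noS; pose A (x : {ffun I -> T}) := ~~ [forall j, g j x == g j0 x].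
pose Q (s : seq J) := [set i | has (fun j => i \notin S j) s].
have step s : avg (fun y => avg (fun x => (g j0 x != g j0 (mix (Q s) x y))%:R)) <=
    2 * (size s)%:R * avg (fun x => (A x)%:R) :> R.
  elim: s => [|j s IH].
    rewrite mulr0 mul0r [leLHS](_ : _ = 0) //.
    rewrite -[RHS](@avg_cst R {ffun I -> T}) //; apply: eq_avg => y.
    rewrite -[RHS](@avg_cst R {ffun I -> T}) //; apply: eq_avg => x.
    have -> : mix (Q [::]) x y = x by apply/ffunP => i; rewrite ffunE inE.
    by rewrite eqxx.
  have -> : 2 * (size (j :: s))%:R * avg (fun x => (A x)%:R) =
    2 * (size s)%:R * avg (fun x => (A x)%:R) + avg (fun x => (A x)%:R)
     + avg (fun x => (A x)%:R) :> R.
    by rewrite /= -natr1; ring.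
  (* Both mixed points [u] and [v] below are uniform, so each pays for one copy of the average of
     [A]. If neither satisfies [A], then [g j0 u = g j u = g j v = g j0 v], as [u] and [v] differ
     only outside [S j]. *)
  rewrite -[X in _ + _ + X](avg_mix (Q (j :: s))) -[X in _ + X + _](avg_mix (Q s)).
  apply: (le_trans _ (lerD (lerD IH (lexx _)) (lexx _))).
  rewrite -!avgD; apply: ler_avg => y; rewrite -!avgD; apply: ler_avg => x.
  set u := mix (Q s) x y; set v := mix _ x y.
  have uv : g j u = g j v.
    by apply: gS => i iS; rewrite !ffunE !inE /= iS.
  case: (boolP (A u)) => [_|]; first by rewrite -!natrD ler_nat; case: (_ != _) => //; lia.
  case: (boolP (A v)) => [_|]; first by rewrite -!natrD ler_nat; case: (g j0 x != g j0 v) => //; lia.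
  rewrite !negbK => /forallP/(_ j)/eqP <- /forallP/(_ j)/eqP <-.
  by rewrite uv !addr0.
have := step (enum J); rewrite -cardE; apply: le_trans.
rewrite le_eqVlt; apply/orP; left; apply/eqP; apply: eq_avg => y; apply: eq_avg => x.
congr ((_ != g j0 _)%:R); apply/ffunP=> i; rewrite ffunE inE.
case: hasP => // -[]; have [j ij] := noS i; exists j => //; exact: mem_enum.
Qed.

Lemma avg_pair_neq (R : realFieldType) (T : finType) (b : T -> bool) :
  (0 < #|T|)%N ->
  avg (fun y => avg (fun x => (b x != b y)%:R)) =
    2 * avg (fun x => (b x)%:R) * (1 - avg (fun x => (b x)%:R)) :> R.
Proof.
move=> T0; set p := avg (fun x => (b x)%:R).
have E y : avg (fun x => (b x != b y)%:R) = p + (1 - 2 * p) * (b y)%:R :> R.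
  case: (b y); last by rewrite mulr0 addr0; apply: eq_avg => x; case: (b x).
  rewrite (eq_avg (h := fun x => (~~ b x)%:R)); last by move=> x; case: (b x).
  by rewrite avg_negb // -/p [true%:R]mulr1n; ring.
by rewrite (eq_avg E) avgD avg_cst // avgZl -/p; ring.
Qed.

Lemma disagreement (R : realType) (I T J : finType) (S : J -> {set I})
    (g : J -> {ffun I -> T} -> bool) (j0 : J) (delta : R) :
  (0 < #|{ffun I -> T}|)%N ->
  (forall j, depends_on (S j) (g j)) -> (forall i, exists j, i \notin S j) ->
  0 <= delta -> delta <= 2^-1 ->
  delta <= avg (fun x => (g j0 x)%:R) -> delta <= avg (fun x => (~~ g j0 x)%:R) ->
  delta / (2 * #|J|%:R) <= avg (fun x => (~~ [forall j, g j x == g j0 x])%:R).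
Proof.
move=> T0 gS noS d0 d2; rewrite avg_negb // => p1 p2.
have J0 : 0 < #|J|%:R :> R by rewrite ltr0n; apply/card_gt0P; exists j0.
have := @resample R I T J S g j0 T0 gS noS.
rewrite avg_pair_neq //; set e := avg (fun x => (~~ [forall _, _])%:R).
rewrite ler_pdivrMr ?mulr_gt0 //.
set p := avg _ in p1 p2 *.
(* The next two inequalities give [p * (1 - p) >= delta * (1 - delta) >= delta / 2]. *)
have pd : 0 <= (p - delta) * (1 - p - delta) by rewrite mulr_ge0 ?subr_ge0 // lerBrDl; lra.
have dd : 0 <= delta * (2^-1 - delta) by rewrite mulr_ge0 ?subr_ge0.
nra.
Qed.

(** * Cells of bounded degree and bad shifts *)

Lemma leq_card_bigcup (I J : finType) (P : pred J) (F : J -> {set I}) :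
  (#|\bigcup_(j | P j) F j| <= \sum_(j | P j) #|F j|)%N.
Proof.
elim/big_ind2: _ => [|x1 x2 y1 y2 h1 h2|//]; rewrite ?cards0 //.
by rewrite (leq_trans (leq_card_setU _ _)) ?leq_add.
Qed.

Lemma prod_leq_exp (J : finType) (a : J -> nat) (D : nat) :
  (\sum_j a j <= #|J| * D)%N -> (\prod_j a j <= D ^ #|J|)%N.
Proof.
move=> aD; have [J0|J0] := posnP #|J|.
  rewrite J0 expn0 big1 // => j _.
  by have := card0_eq J0 j; rewrite !inE.
have a0 : {in J, forall j, 0 <= (a j)%:R :> rat} by move=> j _; exact: ler0n.
have /leifP := leif_AGM a0; rewrite -natr_prod -natr_sum => H.
rewrite -(ler_nat rat) natrX.
apply: (@le_trans _ _ (((\sum_(j in J) a j)%:R / #|J|%:R) ^+ #|J|)).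
  by case: ifP H => _ [] => [/eqP ->|/ltW].
rewrite lerXn2r ?nnegrE ?divr_ge0 ?ler0n // ler_pdivrMr ?ltr0n // -natrM ler_nat.
by rewrite mulnC.
Qed.

Lemma card_ffun_in (J U : finType) (F : J -> {set U}) :
  #|[set s : {ffun J -> U} | [forall j, s j \in F j]]| = (\prod_j #|F j|)%N.
Proof.
have := @card_family J (fun=> U) (fun j => mem (F j)).
rewrite foldrE big_map big_enum /= => <-.
by apply: eq_card => s; rewrite inE.
Qed.

Section Shifts.
Context {I : finType} {ell n : nat}.
Implicit Types (S : option 'I_ell -> 'I_n.+1 -> {set I}) (H : {set I}) (v : 'I_ell -> 'I_n.+1).

(** Block [None] stands for x and block [Some j] for the shifted copy y^(j); [S b r] is the set of
    cells read by bit [r] of block [b]. *)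
Definition degree S (b : option 'I_ell) (c : I) : nat := #|[set r | c \in S b r]|.

Definition heavy S (q : nat) : {set I} := [set c | (q < \sum_b degree S b c)%N].

(* [y^(j)] at position [k - v j] is the copy of [x_k] under the shifts [v]. *)
Definition pos v (b : option 'I_ell) (k : 'I_n.+1) : 'I_n.+1 :=
  if b is Some j then k - v j else k.

(** A cell common to all bits of check [k] blocks the resampling, which must replace each cell
    through a bit that does not read it. *)
Definition bad S v (k : 'I_n.+1) : bool :=
  [exists c, forall b, c \in S b (pos v b k)].

Lemma pos_inj v b : injective (pos v b).
Proof. by case: b => [j|] k l //= /addIr. Qed.

(** Double counting of the pairs formed by a bit and a cell it reads. *)
Lemma card_heavy S (q d : nat) :
  (forall b r, #|S b r| <= d)%N -> (#|heavy S q| * q <= ell.+1 * n.+1 * d)%N.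
Proof.
move=> Sd.
have sum_deg : (\sum_c \sum_b degree S b c = \sum_b \sum_r #|S b r|)%N.
  rewrite exchange_big /=; apply: eq_bigr => b _.
  transitivity (\sum_c \sum_r (c \in S b r))%N.
    apply: eq_bigr => c _; rewrite /degree -sum1_card big_mkcond.
    by apply: eq_bigr => r _; rewrite inE; case: (_ \in _).
  rewrite exchange_big; apply: eq_bigr => r _.
  by rewrite -sum1_card [RHS]big_mkcond; apply: eq_bigr => c _; case: (_ \in _).
apply: (@leq_trans (\sum_c \sum_b degree S b c)%N).
  rewrite -sum_nat_const [leqRHS](bigID (mem (heavy S q))) /=.
  apply: leq_trans (leq_addr _ _); apply: leq_sum => c.
  by rewrite inE => /ltnW.
rewrite sum_deg.
apply: (@leq_trans (\sum_(b : option 'I_ell) \sum_(r < n.+1) d)%N).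
  by apply: leq_sum => b _; apply: leq_sum.
by rewrite !sum_nat_const card_option !card_ord mulnA.
Qed.

Lemma degree_light S H (q : nat) (b : option 'I_ell) (r : 'I_n.+1) (c : I) :
  heavy S q \subset H -> c \in S b r :\: H ->
  (\sum_b' degree (fun b r => S b r :\: H) b' c <= q)%N.
Proof.
move=> /subsetP/(_ c) cH; rewrite inE => /andP[/(contra cH)].
rewrite inE -leqNgt => cL _; apply: leq_trans cL.
apply: leq_sum => b' _; apply/subset_leq_card/subsetP => r'.
by rewrite !inE => /andP[].
Qed.

(** For each block [b], the checks reading [c] through [b] correspond bijectively, by [pos v b], to
    the bits of [b] reading [c]. *)
Lemma read_bound S (q : nat) v (c : I) :
  (forall b r, c \in S b r -> \sum_b' degree S b' c <= q)%N ->
  (#|[set k | c \in \bigcup_b S b (pos v b k)]| <= q)%N.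
Proof.
have [->|[k0]] := set_0Vmem [set k | c \in \bigcup_b S b (pos v b k)].
  by rewrite cards0.
rewrite inE => /bigcupP[b0 _ cb0] /(_ _ _ cb0); apply: leq_trans.
have -> : (\sum_b degree S b c = \sum_b #|[set k | c \in S b (pos v b k)]|)%N.
  apply: eq_bigr => b _; rewrite /degree -[RHS](card_imset _ (@pos_inj v b)).
  apply: eq_card => r; rewrite inE; apply/idP/imsetP => [cr|[k]]; last first.
    by rewrite inE => ck ->.
  case: b cr => [j|] cr; last by exists r; rewrite ?inE.
  by exists (r + v j); rewrite ?inE /= addrK.
apply: (@leq_trans #|\bigcup_b [set k | c \in S b (pos v b k)]|).
  apply/subset_leq_card/subsetP => k; rewrite inE => /bigcupP[b _].
  by move=> ck; apply/bigcupP; exists b; rewrite ?inE.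
exact: leq_card_bigcup.
Qed.

(** The common cell is one of the at most [d] cells of [x_k]. For a fixed cell the shifts are chosen
    independently, the [j]-th in at most [degree S (Some j) c] ways; these degrees sum to at most
    [ell * D], so AM-GM bounds their product by [D ^ ell]. *)
Lemma card_bad S (U : finType) (e : U -> 'I_n.+1) (d D : nat) (k : 'I_n.+1) :
  injective e -> (#|S None k| <= d)%N ->
  (forall b r c, c \in S b r -> \sum_b' degree S b' c <= ell * D)%N ->
  (#|[set s : {ffun 'I_ell -> U} | bad S (e \o s) k]| <= d * D ^ ell)%N.
Proof.
move=> e_inj Sd SD.
apply: (@leq_trans (\sum_(c in S None k)
    #|[set s : {ffun 'I_ell -> U} | [forall j, s j \in [set u | c \in S (Some j) (k - e u)%R]]]|)%N).
  apply: (@leq_trans #|\bigcup_(c in S None k)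
     [set s : {ffun 'I_ell -> U} | [forall j, s j \in [set u | c \in S (Some j) (k - e u)%R]]]|).
    apply/subset_leq_card/subsetP => s; rewrite inE => /existsP[c /forallP cb].
    apply/bigcupP; exists c; first exact: (cb None).
    by rewrite inE; apply/forallP => j; rewrite inE; exact: (cb (Some j)).
  exact: leq_card_bigcup.
apply: (@leq_trans (\sum_(c in S None k) D ^ ell)%N); last by rewrite sum_nat_const leq_mul2r Sd orbT.
apply: leq_sum => c cS; rewrite card_ffun_in.
apply: (@leq_trans (\prod_(j < ell) degree S (Some j) c)%N).
  apply: leq_prod => j _; rewrite /degree -(card_imset _ e_inj).
  have k_inj : injective (fun r : 'I_n.+1 => k - r) by move=> r r' /addrI/oppr_inj.
  rewrite -(card_imset _ k_inj).
  by apply/subset_leq_card/subsetP => r /imsetP[w /imsetP[u]]; rewrite !inE => cu -> ->.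
have := @prod_leq_exp 'I_ell (fun j => degree S (Some j) c) D.
rewrite card_ord; apply.
apply: leq_trans (SD _ _ _ cS).
rewrite [leqRHS](bigD1 None) //= (reindex_omap Some id) => [|[]//].
apply: leq_trans (leq_addl _ _); apply/eq_leq/eq_bigl => j.
by rewrite eqxx.
Qed.

(** Markov's inequality over the shifts, the pairs of a shift vector and a bad check being counted
    check by check. *)
Lemma card_very_bad S (U : finType) (e : U -> 'I_n.+1) (d D : nat) :
  injective e -> (forall b r, #|S b r| <= d)%N ->
  (forall b r c, c \in S b r -> \sum_b' degree S b' c <= ell * D)%N ->
  (#|[set s : {ffun 'I_ell -> U} | n.+1 <= 2 * #|[set k | bad S (e \o s) k]|]|
     <= 2 * d * D ^ ell)%N.
Proof.
move=> e_inj Sd SD; set W := [set s | _].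
rewrite -(leq_pmul2r (ltn0Sn n)) -sum_nat_const.
apply: (@leq_trans (\sum_(s in W) 2 * #|[set k | bad S (e \o s) k]|)%N).
  by apply: leq_sum => s; rewrite inE.
apply: (@leq_trans (\sum_(s : {ffun 'I_ell -> U}) 2 * #|[set k | bad S (e \o s) k]|)%N).
  by rewrite [leqRHS](bigID (mem W)) /= leq_addr.
rewrite -big_distrr /= -!mulnA leq_mul2l /=.
have -> : (\sum_(s : {ffun 'I_ell -> U}) #|[set k | bad S (e \o s) k]| =
   \sum_k #|[set s : {ffun 'I_ell -> U} | bad S (e \o s) k]|)%N.
  transitivity (\sum_(s : {ffun 'I_ell -> U}) \sum_k bad S (e \o s) k)%N.
    apply: eq_bigr => s _; rewrite -sum1_card big_mkcond.
    by apply: eq_bigr => r _; rewrite inE; case: (bad _ _ _).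
  rewrite exchange_big; apply: eq_bigr => r _.
  by rewrite -sum1_card [RHS]big_mkcond; apply: eq_bigr => c _; rewrite inE; case: (bad _ _ _).
apply: (@leq_trans (\sum_(k < n.+1) d * D ^ ell)%N).
  by apply: leq_sum => k _; apply: card_bad.
by rewrite sum_nat_const card_ord mulnC mulnA.
Qed.

End Shifts.

(** * The distinguishing event *)

Lemma depends_mix (I T : finType) (A : Type) (P S : {set I}) (g : {ffun I -> T} -> A)
    (y : {ffun I -> T}) :
  depends_on S g -> depends_on (S :\: P) (fun x => g (mix P x y)).
Proof.
move=> gS x x' xx'; apply: gS => i iS; rewrite !ffunE.
by case: ifPn => // iP; apply: xx'; rewrite inE iP.
Qed.

Lemma card_setCU_ge (K : finType) (A B : {set K}) :
  (4 * #|A| < #|K|)%N -> (2 * #|B| < #|K|)%N -> (#|K| <= 4 * #|~: (A :|: B)|)%N.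
Proof. by have := cardsC (A :|: B); have := (leq_card_setU A B).1; lia. Qed.

Section FixedInput.
Context {R : realType} {I T : finType} {ell n : nat}.
Variables (g : option 'I_ell -> 'I_n.+1 -> {ffun I -> T} -> bool).

(** The threshold is that of [chernoff_many]; above it, both values are frequent enough for
    [disagreement]. *)
Definition biased : {set 'I_n.+1} :=
  [set k | (avg (fun x => (g None k x)%:R) < expR (-8) / 2 :> R) ||
           (avg (fun x => (~~ g None k x)%:R) < expR (-8) / 2 :> R)].

Definition likely (k : 'I_n.+1) : bool :=
  ~~ (avg (fun x => (g None k x)%:R) < expR (-8) / 2 :> R).

Variables (S : option 'I_ell -> 'I_n.+1 -> {set I}) (D : nat).
Hypotheses (T0 : (0 < #|{ffun I -> T}|)%N) (ell0 : (0 < ell)%N) (D0 : (0 < D)%N).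
Hypothesis gS : forall b k, depends_on (S b k) (g b k).
Hypothesis SD : forall b r c, c \in S b r -> (\sum_b' degree S b' c <= ell * D)%N.

(** An exponent that serves both tests. The consistency test is the tighter one: a quarter of the
    checks remain, three factors 2 come from the tail bounds, and [ell + 1 <= 2 * ell] gives the
    last one, 64 in all. *)
Let rate : R := expR (-8) / 64 * n.+1%:R / (ell%:R ^+ 2 * D%:R).

Lemma biased_test : (n.+1 <= 4 * #|biased|)%N ->
  avg (fun x => (#|biased| <= 8 * #|[set k in biased | g None k x != likely k]|)%N%:R)
    <= expR (- rate).
Proof.
move=> nB; have q0 : (0 < ell * D)%N by rewrite muln_gt0 ell0.
apply: (le_trans (@chernoff_many R I T _ biased (fun k => S None k) (ell * D)
   (fun k x => g None k x != likely k) T0 q0 _ _ _)).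
(* Only bits of x matter here, so any shifts will do; they are taken to be 0. *)
- move=> c; apply: leq_trans (@read_bound I ell n S (ell * D) (fun=> 0) c (fun b r => @SD b r c)).
  apply/subset_leq_card/subsetP => k; rewrite !inE => /andP[_ ck].
  by apply/bigcupP; exists None.
- by move=> k x y xy; rewrite (gS xy).
- move=> k; rewrite inE /likely; case: ltP => [lt _|ge /= lt].
    by rewrite (eq_avg (h := fun x => (g None k x)%:R)) ?ltW // => x; case: (g _ _ _).
  by rewrite (eq_avg (h := fun x => (~~ g None k x)%:R)) ?ltW // => x; case: (g _ _ _).
rewrite ler_expR lerN2 /rate.
have e1 : expR (-8) <= 1 :> R by rewrite expR_le1; lra.
have l1 : 1 <= ell%:R :> R by rewrite ler1n.
have D1 : 1 <= D%:R :> R by rewrite ler1n.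
have nB' : n.+1%:R <= 4 * #|biased|%:R :> R by rewrite -natrM ler_nat.
rewrite natrM expr2 ler_pdivrMr ?mulr_gt0 ?(lt_le_trans ltr01) //.
have -> : #|biased|%:R / (2 * (ell%:R * D%:R)) * (ell%:R * ell%:R * D%:R) = #|biased|%:R * ell%:R / 2 :> R.
  by field; rewrite !gt_eqF // (lt_le_trans ltr01).
have n0 : 0 <= n.+1%:R :> R by [].
have := expR_gt0 (-8 : R); nra.
Qed.

(** At least a quarter of the checks are neither biased nor bad. Each of them fails with probability
    at least [expR (-8) / (4 * (ell + 1))], and no cell is read by more than [ell * D] of them. *)
Lemma consistency_test (v : 'I_ell -> 'I_n.+1) :
  (4 * #|biased| < n.+1)%N -> (2 * #|[set k | bad S v k]| < n.+1)%N ->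
  avg (fun x => [forall k, forall b, g b (pos v b k) x == g None k x]%:R)
    <= expR (- rate).
Proof.
move=> nB nbad; have q0 : (0 < ell * D)%N by rewrite muln_gt0 ell0.
set K := ~: (biased :|: [set k | bad S v k]).
have nK : (n.+1 <= 4 * #|K|)%N.
  by have := @card_setCU_ge _ biased [set k | bad S v k]; rewrite card_ord; apply.
pose F (k : 'I_n.+1) x := ~~ [forall b, g b (pos v b k) x == g None k x].
apply: (@le_trans _ _ (avg (fun x => [forall k in K, ~~ F k x]%:R))).
  apply: ler_avg => x; rewrite ler_nat; case: forallP => //= H.
  rewrite (_ : [forall k in K, _]) //; apply/forall_inP => k _.
  by rewrite negbK; apply: H.
have l1 : 1 <= ell%:R :> R by rewrite ler1n.
have D1 : 1 <= D%:R :> R by rewrite ler1n.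
have e1 : expR (-8) <= 1 :> R by rewrite expR_le1; lra.
have e0 := expR_gt0 (-8 : R).
apply: (le_trans (@chernoff_none R I T _ K (fun k => \bigcup_b S b (pos v b k)) (ell * D)
   F (expR (-8) / 2 / (2 * #|{: option 'I_ell}|%:R)) T0 q0 _ _ _)).
- move=> c; apply: leq_trans (@read_bound I ell n S (ell * D) v c (fun b r => @SD b r c)).
  by apply/subset_leq_card/subsetP => k; rewrite !inE => /andP[].
- move=> k x y xy; congr (~~ _); apply: eq_forallb => b.
  have E b' : g b' (pos v b' k) x = g b' (pos v b' k) y.
    by apply: gS => i iS; apply: xy; apply/bigcupP; exists b'.
  by rewrite E (E None).
- move=> k; rewrite !inE !negb_or -!leNgt => /andP[/andP[p1 p2] gk].
  have := @disagreement R I T _ (fun b => S b (pos v b k)) (fun b => g b (pos v b k))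
    None (expR (-8) / 2) T0 _ _ _ _ p1 p2; apply.
  + by move=> b; apply: gS.
  + by move=> c; have /existsPn/(_ c)/forallPn[b cb] := gk; exists b.
  + by rewrite divr_ge0 ?ltW.
  + lra.
rewrite ler_expR lerN2 /rate card_option card_ord.
have nK' : n.+1%:R <= 4 * #|K|%:R :> R by rewrite -natrM ler_nat.
rewrite natrM expr2 ler_pdivrMr ?mulr_gt0 ?(lt_le_trans ltr01) //.
have -> : #|K|%:R * (expR (-8) / 2 / (2 * ell.+1%:R)) / (2 * (ell%:R * D%:R)) * (ell%:R * ell%:R * D%:R)
   = expR (-8) / 8 * #|K|%:R * (ell%:R / ell.+1%:R) :> R.
  by field; apply/and3P; split; apply: lt0r_neq0; lra.
have hl : 2^-1 <= ell%:R / ell.+1%:R :> R.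
  by rewrite ler_pdivlMr ?ltr0Sn // -[ell.+1%:R]natr1; lra.
have n0 : 0 <= n.+1%:R :> R by [].
apply: (@le_trans _ _ (expR (-8) / 8 * #|K|%:R * 2^-1)); first nra.
by rewrite ler_wpM2l // mulr_ge0 ?ler0n ?divr_ge0 // ltW.
Qed.

End FixedInput.

Lemma avg_fst (R : realFieldType) (T U : finType) (g : T -> R) :
  (0 < #|U|)%N -> avg (fun p : T * U => g p.1) = avg g.
Proof.
move=> U0; have U0R : #|U|%:R != 0 :> R by rewrite pnatr_eq0 -lt0n.
rewrite /avg card_prod natrM invfM mulrA.
rewrite -(pair_big predT predT (fun t (u : U) => g t)) /=.
under eq_bigr do rewrite sumr_const -[g _ *+ _]mulr_natr.
by rewrite -mulr_suml mulrAC mulfK // mulrAC.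
Qed.

Lemma avg_snd (R : realFieldType) (T U : finType) (g : U -> R) :
  (0 < #|T|)%N -> avg (fun p : T * U => g p.2) = avg g.
Proof.
move=> T0; have T0R : #|T|%:R != 0 :> R by rewrite pnatr_eq0 -lt0n.
rewrite /avg card_prod natrM invfM mulrA.
rewrite -(pair_big predT predT (fun (t : T) u => g u)) exchange_big /=.
under eq_bigr do rewrite sumr_const -[g _ *+ _]mulr_natr.
by rewrite -mulr_suml mulfK.
Qed.

Lemma avg_bool (R : realFieldType) (T : finType) (b : T -> bool) :
  avg (fun t => (b t)%:R) = #|[set t | b t]|%:R / #|T|%:R :> R.
Proof.
rewrite /avg -sum1_card natr_sum [in RHS]big_mkcond /=; congr (_ / _).
by apply: eq_bigr => t _; rewrite inE; case: (b t).
Qed.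

Lemma card_supported (I T : finType) (a : T) (H : {set I}) :
  (#|[set y : {ffun I -> T} | [forall i, (i \notin H) ==> (y i == a)]]| <= #|T| ^ #|H|)%N.
Proof.
rewrite -(card_pffun_on a (mem H) predT).
apply/subset_leq_card/subsetP => y; rewrite inE => /forallP yH.
apply/pffun_onP; split=> //; apply/subsetP => i; rewrite inE.
by apply: contraR => /(implyP (yH i)).
Qed.

(** [sh] extracts the shifts of an output, [out] the bits of its blocks, and [ds] generates the
    target strings. [h] counts the fixed cells: those deciding the shifts and the heavy ones. *)
Lemma distinguisher (R : realType) (I T U V : finType) (ell n d D t : nat)
    (e : U -> 'I_n.+1) (sh : V -> {ffun 'I_ell -> U})
    (out : option 'I_ell -> 'I_n.+1 -> V -> bool)
    (ds : {ffun 'I_ell -> U} * {ffun 'I_n.+1 -> bool} -> V)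
    (f : {ffun I -> T} -> V) (S0 : {set I}) (S : option 'I_ell -> 'I_n.+1 -> {set I}) :
  (0 < #|T|)%N -> (0 < ell)%N -> (0 < D)%N -> bijective e ->
  (forall p, sh (ds p) = p.1) ->
  (forall p r, out None r (ds p) = p.2 r) ->
  (forall p j r, out (Some j) r (ds p) = p.2 (r + e (p.1 j))) ->
  depends_on S0 (sh \o f) -> (#|S0| <= t)%N ->
  (forall b r, depends_on (S b r) (out b r \o f)) ->
  (forall b r, #|S b r| <= d)%N ->
  exists (E : {set V}) (h : nat),
    [/\ (h * (ell * D) <= t * (ell * D) + ell.+1 * n.+1 * d)%N,
        1 - expR (- (expR (-8) / 64 * n.+1%:R / (ell%:R ^+ 2 * D%:R))) <=
          avg (fun x => (f x \in E)%:R) :> R &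
        avg (fun p => (ds p \in E)%:R) <=
          (2 * d * D ^ ell)%:R / n.+1%:R ^+ ell + #|T|%:R ^+ h * expR (- (n.+1%:R / 32)) :> R].
Proof.
move=> T0 ell0 D0 e_bij dsS dsN dsJ fS S0t outS Sd.
have e_inj := bij_inj e_bij.
have cardU : #|U| = n.+1 by rewrite (bij_eq_card e_bij) card_ord.
have [a _] := card_gt0P T0.
have O0 : (0 < #|{ffun I -> T}|)%N by apply/card_gt0P; exists [ffun=> a].
pose H := S0 :|: heavy S (ell * D).
pose S' b r := S b r :\: H.
pose g y b r x := out b r (f (mix H x y)).
pose B y := biased (R := R) (g y); pose lk y := likely (R := R) (g y).
(* One representative for each assignment to the fixed cells, with the default [a] elsewhere, so
   that the union bound has at most [#|T| ^ #|H|] terms. *)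
pose Rep := [set y : {ffun I -> T} | [forall i, (i \notin H) ==> (y i == a)]].
pose W (s : {ffun 'I_ell -> U}) := (n.+1 <= 2 * #|[set k | bad S' (e \o s) k]|)%N.
(* At most an eighth of the biased positions deviate from their likely values: typical for [f] under
   the assignment [y] if many positions are biased, rare for uniform x. *)
pose far y z := (8 * #|[set k in B y | out None k z != lk y k]| <= #|B y|)%N.
pose E := [set z | [|| W (sh z),
  [exists y in Rep, (n.+1 <= 4 * #|B y|)%N && far y z] |
  ~~ [forall k, forall b, out b (pos (e \o sh z) b k) z == out None k z]]].
have gS y b r : depends_on (S' b r) (g y b r).
  exact: (depends_mix (g := out b r \o f)).
have S'D b r c : c \in S' b r -> (\sum_b' degree S' b' c <= ell * D)%N.
  by apply: degree_light; exact: subsetUr.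
have S'd b r : (#|S' b r| <= d)%N by rewrite (leq_trans _ (Sd b r)) ?subset_leq_card ?subsetDl.
exists E, #|H|; split.
- apply: (@leq_trans ((#|S0| + #|heavy S (ell * D)|) * (ell * D))).
    by rewrite leq_mul2r (leq_card_setU S0 _).1 orbT.
  by rewrite mulnDl leq_add ?card_heavy // leq_mul2r S0t orbT.
(* The complement of [E] is bounded with the cells of [H] drawn first, uniformly in their values. *)
- rewrite lerBlDl -lerBlDr -avg_negb // -(avg_mix H).
  rewrite -[leRHS](@avg_cst R {ffun I -> T}) //; apply: ler_avg => y0.
  pose y : {ffun I -> T} := [ffun i => if i \in H then y0 i else a].
  have yRep : y \in Rep.
    by rewrite inE; apply/forallP => i; apply/implyP => iH; rewrite ffunE (negPf iH).
  have yy0 x : mix H x y0 = mix H x y.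
    by apply/ffunP => i; rewrite !ffunE; case: (i \in H).
  under eq_avg do rewrite yy0.
  have [nB|nB] := leqP n.+1 (4 * #|B y|).
    apply: le_trans (@biased_test R I T ell n (g y) S' D O0 ell0 D0 (gS y) S'D nB).
    apply: ler_avg => x; rewrite ler_nat; case: (leqP #|biased (g y)|) => [_|lt8]; first exact: leq_b1.
    rewrite leqn0 eqb0 negbK inE; apply/or3P/Or32; apply/existsP; exists y.
    by rewrite yRep nB /far ltnW.
  (* Since [S0] lies in [H], the shifts are already determined and any filling of the other cells
     computes them. *)
  pose s := sh (f (mix H [ffun=> a] y)).
  have sE x : sh (f (mix H x y)) = s.
    apply: (@depends_mix I T _ H S0 (sh \o f) y fS) => i.
    by rewrite inE /H inE; case: (i \in S0); rewrite ?andbF.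
  have [Ws|Ws] := boolP (W s).
    rewrite (eq_avg (h := fun=> 0)) ?avg_cst ?expR_ge0 // => x.
    by rewrite inE sE Ws.
  rewrite /W -ltnNge in Ws.
  apply: le_trans (@consistency_test R I T ell n (g y) S' D O0 ell0 D0 (gS y) S'D (e \o s) nB Ws).
  apply: ler_avg => x; rewrite ler_nat; case: (boolP (_ \in E)) => //.
  by rewrite inE sE lt0b => /norP[_ /norP[_ /negbNE]].
- have U0 : (0 < #|{ffun 'I_ell -> U}|)%N by rewrite card_ffun cardU expn_gt0.
  have X0 : (0 < #|{ffun 'I_n.+1 -> bool}|)%N by rewrite card_ffun card_bool expn_gt0.
  (* Union bound. On [ds p] every check succeeds because [(k - e (s j)) + e (s j) = k], so only the
     first two clauses of [E] contribute. *)
  apply: (@le_trans _ _ (avg (fun p : {ffun 'I_ell -> U} * {ffun 'I_n.+1 -> bool} =>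
     (W p.1)%:R + \sum_(y in Rep | (n.+1 <= 4 * #|B y|)%N)
       ((8 * #|[set k in B y | p.2 k != lk y k]| <= #|B y|)%N)%:R))).
    apply: ler_avg => p.
    have sum0 (Q : pred {ffun I -> T}) (F : {ffun I -> T} -> bool) : 0 <= \sum_(y | Q y) (F y)%:R :> R.
      by rewrite sumr_ge0 // => y _; rewrite ler0n.
    case: (boolP (ds p \in E)) => [|_]; last by rewrite addr_ge0.
    rewrite inE dsS => /or3P[->|/existsP[y /and3P[yR nB yf]]|/negP[]]; first by rewrite lerDl.
      rewrite ler_wpDl ?ler0n // (bigD1 y) ?yR //= -[leLHS]addr0.
      apply: lerD; last exact: sum0.
      have <- : [set k in B y | out None k (ds p) != lk y k] =
                [set k in B y | p.2 k != lk y k] by apply/setP => k; rewrite !inE dsN.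
      by move: yf; rewrite /far => ->.
    apply/forallP => k; apply/forallP => -[j|] //=.
    by rewrite dsJ dsN /= subrK.
  rewrite avgD avg_sum; apply: lerD.
    rewrite (avg_fst (fun s => (W s)%:R)) // avg_bool card_ffun cardU card_ord natrX ler_wpM2r ?invr_ge0 ?exprn_ge0 //.
    by rewrite ler_nat; apply: card_very_bad.
  apply: (@le_trans _ _ (\sum_(y in Rep | (n.+1 <= 4 * #|B y|)%N) expR (- (n.+1%:R / 32)))).
    apply: ler_sum => y /andP[_ nB].
    rewrite (avg_snd (fun x : {ffun 'I_n.+1 -> bool} =>
       ((8 * #|[set k in B y | x k != lk y k]| <= #|B y|)%N)%:R)) //.
    apply: le_trans (hamming_ball R _ _) _; rewrite ler_expR lerN2.
    have : n.+1%:R <= 4 * #|B y|%:R :> R by rewrite -natrM ler_nat.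
    lra.
  apply: (@le_trans _ _ (\sum_(y in Rep) expR (- (n.+1%:R / 32)))).
    rewrite [leRHS](bigID (fun y => (n.+1 <= 4 * #|B y|)%N)) /= lerDl.
    by rewrite sumr_ge0 // => y _; exact: expR_ge0.
  rewrite sumr_const -[_ *+ _]mulr_natl ler_wpM2r ?expR_ge0 //.
  by rewrite -natrX ler_nat; exact: card_supported.
Qed.

(** * Coordinates of the output and the choice of constants *)

Section Coordinates.
Context {k ell n : nat}.

Lemma shift_lt (j : 'I_ell) (t : 'I_k) : (j * k + t < Dlen k ell n)%N.
Proof. by have := ltn_ord j; have := ltn_ord t; rewrite /Dlen; nia. Qed.

Lemma source_lt (r : 'I_n) : (ell * k + r < Dlen k ell n)%N.
Proof. by have := ltn_ord r; rewrite /Dlen mulSn; lia. Qed.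

Lemma copy_lt (j : 'I_ell) (r : 'I_n) : (ell * k + n + (j * n + r) < Dlen k ell n)%N.
Proof. by have := ltn_ord j; have := ltn_ord r; rewrite /Dlen; nia. Qed.

Definition shift_bit (z : {ffun 'I_(Dlen k ell n) -> bool}) :
    {ffun 'I_ell -> {ffun 'I_k -> bool}} :=
  [ffun j => [ffun t => z (Ordinal (shift_lt j t))]].

Definition block (b : option 'I_ell) (r : 'I_n) : 'I_(Dlen k ell n) :=
  if b is Some j then Ordinal (copy_lt j r) else Ordinal (source_lt r).

Lemma getb_ord m (x : {ffun 'I_m -> bool}) (i : 'I_m) : getb x i = x i.
Proof. by rewrite /getb valK. Qed.

Variable enc : {ffun 'I_k -> bool} -> 'I_n.

Lemma shift_bit_Dstring p : shift_bit (@Dstring k ell n enc p) = p.1.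
Proof.
apply/ffunP => j; apply/ffunP => t; rewrite !ffunE /=.
have jt : (j * k + t < ell * k)%N by have := ltn_ord j; have := ltn_ord t; nia.
have k0 : (0 < k)%N by apply: leq_ltn_trans (ltn_ord t).
by rewrite jt divnMDl // divn_small // addn0 valK modnMDl modn_small // getb_ord.
Qed.

Lemma block_Dstring_source p r : @Dstring k ell n enc p (block None r) = p.2 r.
Proof.
rewrite ffunE /= ltnNge leq_addr /= ltn_add2l ltn_ord.
by rewrite addKn getb_ord.
Qed.

End Coordinates.

Lemma block_Dstring_copy (k ell n : nat) (enc : {ffun 'I_k -> bool} -> 'I_n.+1) p
    (j : 'I_ell) (r : 'I_n.+1) :
  @Dstring k ell n.+1 enc p (block (Some j) r) = p.2 (r + enc (p.1 j)).
Proof.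
rewrite ffunE /= -addnA ltnNge leq_addr /= ltn_add2l ltnNge leq_addr /=.
rewrite addKn addKn divnMDl // divn_small // addn0 valK modnMDl (modn_small (ltn_ord r)).
exact: (getb_ord p.2 (r + enc (p.1 j))).
Qed.

Section Rates.
Context {R : realType}.

Lemma ln2_le1 : ln 2 <= 1 :> R.
Proof. by have := @le_ln1Dx R 1; rewrite (_ : 1 + 1 = 2) //; apply; lra. Qed.

Lemma ln2_gt0 : 0 < ln 2 :> R.
Proof. by rewrite ln_gt0 // ltr1n. Qed.

Lemma ln_pow2 (k : nat) : ln (2 ^ k)%N%:R / ln 2 = k%:R :> R.
Proof. by rewrite natrX lnXn // -[ln 2 *+ k]mulr_natl mulfK // gt_eqF ?ln2_gt0. Qed.

(** [D] has to be an integer, so [up_log 2 N] replaces the logarithm, at the cost of a factor 2. *)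
Lemma up_log_bounds_log2 (N : nat) : (2 <= N)%N ->
  [/\ ln N%:R <= ln N%:R / ln 2 :> R, ln N%:R <= (up_log 2 N)%:R :> R,
      1 <= ln N%:R / ln 2 :> R & (up_log 2 N)%:R <= 2 * (ln N%:R / ln 2) :> R].
Proof.
move=> N2; have l2 := ln2_gt0; have l21 := ln2_le1.
have N0 : 0 < N%:R :> R by rewrite ltr0n; lia.
have lnN : ln 2 <= ln N%:R :> R by rewrite ler_ln ?posrE // ler_nat.
have p2 m : 0 < (2 ^ m)%N%:R :> R by rewrite ltr0n expn_gt0.
have lnE m : ln (2 ^ m)%N%:R = m%:R * ln 2 :> R by rewrite natrX lnXn // mulr_natl.
have /andP[lo hi] := up_log_bounds (isT : 1 < 2)%N N2.
have w0 : (0 < up_log 2 N)%N by rewrite up_log_gt0.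
have w1 : 1 <= ln N%:R / ln 2 :> R by rewrite ler_pdivlMr // mul1r.
have lo' : (up_log 2 N).-1%:R <= ln N%:R / ln 2 :> R.
  by rewrite ler_pdivlMr // -lnE ler_ln ?posrE // ler_nat ltnW.
have hi' : ln N%:R <= (up_log 2 N)%:R * ln 2 :> R.
  by rewrite -lnE ler_ln ?posrE // ler_nat.
split => //.
- by rewrite ler_pdivlMr // ler_piMr // (le_trans _ lnN) // ltW.
- by rewrite (le_trans hi') // ler_piMr.
- by rewrite -(prednK w0) -natr1; lra.
Qed.

(** Source of the constants: [16384 = 64 * 128 * 2] and [512 = 2 * 128 * 2], the last 2 being the
    cost of rounding the logarithm, and [1/64 = 1/32 - 1/64]. *)
Lemma rates (n ell d k N h : nat) : (0 < d)%N -> (0 < ell)%N -> (0 < n)%N -> (2 <= N)%N ->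
  let w : R := ln N%:R / ln 2 in let D := (128 * d * up_log 2 N)%N in
  (h * (ell * D) <= ell * k * d * (ell * D) + ell.+1 * n * d)%N ->
  [/\ expR (- (expR (-8) / 64 * n%:R / (ell%:R ^+ 2 * D%:R))) <=
        expR (- (expR (-8) / 16384 * n%:R / (ell%:R ^+ 2 * d%:R * w))) :> R,
      (2 * d * D ^ ell)%:R / n%:R ^+ ell <= d%:R * (512 * d%:R * w / n%:R) ^+ ell :> R &
      N%:R ^+ h * expR (- (n%:R / 32)) <= expR (d%:R * ell%:R * k%:R * w - 1 / 64 * n%:R) :> R].
Proof.
move=> d0 ell0 n0 N2 w D hD.
have [lnw lnu w1 uw] := up_log_bounds_log2 N2.
rewrite -/w in lnw w1 uw; clearbody w; set u := (up_log 2 N)%:R in lnu uw.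
have DE : D%:R = 128 * d%:R * u :> R by rewrite /D !natrM.
have d1 : 1 <= d%:R :> R by rewrite ler1n.
have l1 : 1 <= ell%:R :> R by rewrite ler1n.
have n1 : 1 <= n%:R :> R by rewrite ler1n.
have u1 : 1 <= u by rewrite ler1n up_log_gt0.
have e0 := expR_gt0 (-8 : R).
have w0 : 0 < w by lra.
split.
- rewrite ler_expR lerN2 DE.
  have -> : expR (-8) / 64 * n%:R / (ell%:R ^+ 2 * (128 * d%:R * u)) =
    (expR (-8) / 8192 * n%:R / (ell%:R ^+ 2 * d%:R)) * u^-1.
    by field; apply/and3P; split; apply: lt0r_neq0; lra.
  have -> : expR (-8) / 16384 * n%:R / (ell%:R ^+ 2 * d%:R * w) =
    (expR (-8) / 8192 * n%:R / (ell%:R ^+ 2 * d%:R)) * (2 * w)^-1.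
    by field; apply/and3P; split; apply: lt0r_neq0; lra.
  rewrite ler_wpM2l //.
    by rewrite !(mulr_ge0, invr_ge0, divr_ge0, exprn_ge0) // ltW.
  by rewrite lef_pV2 ?posrE; lra.
- have -> : (2 * d * D ^ ell)%:R / n%:R ^+ ell = d%:R * (2 * (D%:R / n%:R) ^+ ell) :> R.
    by rewrite natrM natrX natrM expr_div_n !mulrA [2 * _]mulrC.
  rewrite ler_wpM2l //.
  have n0' : 0 <= n%:R^-1 :> R by rewrite invr_ge0.
  (* The leading 2 is absorbed into the power because [ell >= 1]. *)
  apply: (@le_trans _ _ ((2 * (D%:R / n%:R)) ^+ ell)).
    rewrite [leRHS]exprMn ler_wpM2r ?exprn_ge0 ?divr_ge0 //.
    by rewrite -[leLHS]expr1 ler_weXn2l // ler1n.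
  have dw0 : 0 <= 512 * d%:R * w / n%:R :> R.
    by rewrite divr_ge0 // !mulr_ge0 // ltW.
  have Dn0 : 0 <= 2 * (D%:R / n%:R) :> R by rewrite mulr_ge0 ?divr_ge0.
  rewrite lerXn2r // mulrA ler_wpM2r // DE.
  by nra.
- have N0 : 0 < N%:R :> R by rewrite ltr0n; lia.
  rewrite -[N%:R](@lnK R) ?posrE // -expRM_natl -expRD ler_expR.
  have lnN0 : 0 <= ln N%:R :> R by rewrite ln_ge0 // ler1n; lia.
  have hR : h%:R * (ell%:R * (128 * d%:R * u)) <=
     ell%:R * k%:R * d%:R * (ell%:R * (128 * d%:R * u)) + (ell%:R + 1) * n%:R * d%:R :> R.
    by move: hD; rewrite -(ler_nat R) !(natrD, natrM) -DE /D !natrM natr1.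
  (* Dividing by [ell * D] and using [ell + 1 <= 2 * ell] leaves at most [n / (64 * u)] heavy cells;
     [ln N <= u] then makes their assignments cost at most [expR (n / 64)]. *)
  have hle : h%:R <= ell%:R * k%:R * d%:R + n%:R / (64 * u).
    have p0 : 0 < ell%:R * (128 * d%:R * u) by rewrite !mulr_gt0 //; lra.
    rewrite -(ler_pM2r p0) (le_trans hR) // [leRHS]mulrDl lerD2l.
    have -> : n%:R / (64 * u) * (ell%:R * (128 * d%:R * u)) = 2 * ell%:R * n%:R * d%:R.
      by field; apply: lt0r_neq0; lra.
    by rewrite !ler_wpM2r //; lra.
  have k0 : 0 <= ell%:R * k%:R * d%:R :> R by rewrite !mulr_ge0.
  have t1 : ell%:R * k%:R * d%:R * ln N%:R <= ell%:R * k%:R * d%:R * w by rewrite ler_wpM2l.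
  have t2 : n%:R / (64 * u) * ln N%:R <= n%:R / 64.
    have -> : n%:R / (64 * u) * ln N%:R = n%:R / 64 * (ln N%:R / u).
      by field; apply: lt0r_neq0; lra.
    by rewrite ler_piMr ?divr_ge0 // ler_pdivrMr ?mul1r //; lra.
  have := ler_wpM2r lnN0 hle; rewrite mulrDl; lra.
Qed.

End Rates.

Lemma advantage_bound (R : realFieldType) (a a' b b' c c' p q : R) :
  a <= a' -> b <= b' -> c <= c' -> 1 - a <= p -> q <= b + c ->
  1 - a' - b' - c' <= p - q.
Proof. by move=> *; lra. Qed.

Theorem theorem3 :
  exists c1 c2 C : R, [/\ 0 < c1, 0 < c2, 0 < C &
  forall (m d ell n N k : nat) (enc : {ffun 'I_k -> bool} -> 'I_n)
         (f : {ffun 'I_m -> 'I_N} -> {ffun 'I_(Dlen k ell n) -> bool}),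
    (1 <= d)%N -> (d <= m)%N -> (1 <= ell)%N -> (2 <= n)%N -> (2 <= N)%N ->
    n = (2 ^ k)%N -> bijective enc ->
    local d f ->
    tv_dist (unif_push f) (@Ddist k ell n enc) >=
      1 - exp (- (c1 * n%:R / (ell%:R ^+ 2 * d%:R * log2 N%:R)))
        - d%:R * (C * d%:R * log2 N%:R / n%:R) ^+ ell
        - exp (d%:R * ell%:R * log2 n%:R * log2 N%:R - c2 * n%:R)].
Proof.
exists (expR (-8) / 16384), (1 / 64), 512; split; first by rewrite divr_gt0 ?expR_gt0.
- by rewrite divr_gt0.
- by [].
(* With a successor as length, the ordinals carry the addition of Z_n. *)
move=> m d ell [//|n] N k enc f d0 _ ell0 _ N2 nE enc_bij /fin_all_exists[S fS].
pose S0 := \bigcup_(j < ell) \bigcup_(t < k) S (Ordinal (shift_lt (n := n.+1) j t)).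
have S0d : (#|S0| <= ell * k * d)%N.
  apply: leq_trans (leq_card_bigcup _ _) _.
  rewrite -mulnA -[X in (_ <= X * _)%N]card_ord -sum_nat_const leq_sum // => j _.
  apply: leq_trans (leq_card_bigcup _ _) _.
  rewrite -[X in (_ <= X * _)%N]card_ord -sum_nat_const leq_sum // => t _.
  by case: (fS (Ordinal (shift_lt j t))).
(* With this [D], fixing the heavy cells costs a factor at most [expR (n / 64)]. *)
pose D := (128 * d * up_log 2 N)%N.
have D0 : (0 < D)%N by rewrite !muln_gt0 d0 up_log_gt0 /=.
have T0 : (0 < #|'I_N|)%N by rewrite card_ord; lia.
have [|b r|b r|E [h [hD PE QE]]] := @distinguisher R _ _ _ _ ell n d D (ell * k * d) enc
    shift_bit (fun b r z => z (block b r)) (Dstring enc) f S0 (fun b r => S (block b r))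
    T0 ell0 D0 enc_bij (shift_bit_Dstring enc) (block_Dstring_source enc)
    (block_Dstring_copy enc) _ S0d.
- move=> x y xy; apply/ffunP => j; apply/ffunP => t; rewrite !ffunE.
  have [_ +] := fS (Ordinal (shift_lt j t)); apply => i iS; apply: xy.
  by apply/bigcupP; exists j => //; apply/bigcupP; exists t.
- by have [] := fS (block b r).
- by have [] := fS (block b r).
have [r1 r2 r3] := @rates R n.+1 ell d k N h d0 ell0 isT N2 hD.
(* Any single event bounds the total variation distance from below. *)
have tvE : avg (fun x => (f x \in E)%:R) - avg (fun p => (Dstring enc p \in E)%:R)
    <= tv_dist (unif_push f) (@Ddist k ell n.+1 enc).
  rewrite !avg_bool.
  exact: (le_bigmax (0 : R) (fun E => unif_push f E - @Ddist k ell n.+1 enc E) E).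
have log2E (x : R) : log2 x = ln x / ln 2 by rewrite /log2 RdivE !RlnE.
have log2n : log2 n.+1%:R = k%:R by rewrite log2E nE ln_pow2.
apply: le_trans tvE; rewrite !RexpE log2n log2E !(RminusE, RmultE, RoppE, RdivE).
rewrite card_ord in QE.
exact: (advantage_bound r1 r2 r3 PE QE).
Qed.
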